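(* Let $X$ be a two-sided subshift on a finite alphabet $\mathcal{A}$ endowed with a shift-invariant probability measure $\mu$ on $X$ which is positive on all cylinders in $X$, mixing, and non-atomic. Then for any $\epsilon>0$ there exists a finite union of shifted cylinders $\mathcal{C} := \bigcup_{i=1}^n \sigma^{-r_i}[w_i]$ (with $w_i\in\mathcal{L}(X)$, $r_i\in\mathbb{Z}$) such that (1) $\mu(\mathcal{C})<\epsilon$; (2) $\mathcal{C}$ is a complete trap; (3) for all $i,j\in\{1,\dots,n\}$ we have $\mu(\sigma^{-r_i}[w_i]\cap\sigma^{-r_j}[w_j])>0$.
   Context: Let $\mathcal{A}$ be a finite alphabet and $\sigma:\mathcal{A}^{\mathbb{Z}}\to\mathcal{A}^{\mathbb{Z}}$ the left shift, $(\sigma x)_i=x_{i+1}$. A (two-sided) subshift is a set $X\subset\mathcal{A}^{\mathbb{Z}}$, closed in the product topology, with $\sigma(X)=X$. $\mathcal{L}_n(X)$ denotes the set of words of length $n$ occurring in elements of $X$ and $\mathcal{L}(X)=\bigcup_{n\ge0}\mathcal{L}_n(X)$. For $w=w_1\dots w_n\in\mathcal{L}(X)$ the cylinder $[w]$ is the set of all $(x_j)_{j\in\mathbb{Z}}\in X$ with $x_1=w_1,\dots,x_n=w_n$. A shifted cylinder is a set $\sigma^{-r}[w]$. The measure $\mu$ is non-atomic if $\mu(\{x\})=0$ for every $x\in X$; it is mixing if $\mu(\sigma^{-n}[w]\cap[w'])\to\mu([w])\mu([w'])$ as $n\to+\infty$ for every pair of cylinders $[w],[w']$. A Borel set $A\subset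 X$ is a complete trap if for every $x\in X$ there exists $n\in\mathbb{Z}$ with $\sigma^n x\in A$. *)

(* Defs.v *)
From HB Require Import structures.
From mathcomp Require Import all_boot all_order all_algebra.
From mathcomp Require Import all_classical all_reals all_analysis.

Set Implicit Arguments.
Unset Strict Implicit.
Unset Printing Implicit Defensive.

Import Order.TTheory GRing.Theory Num.Theory.

Local Open Scope classical_set_scope.
Local Open Scope ring_scope.

(* A^Z with the product of the discrete topologies.  The alphabet is a
   pointedType because measurable types are pointed in MathComp-Analysis; its
   finiteness is a hypothesis of the theorem. *)
Definition full_shift (A : pointedType) : Type :=
  {ptws int -> discrete_topology A}.

HB.instance Definition _ (A : pointedType) :=
  Uniform.copy (full_shift A) {ptws int -> discrete_topology A}.
HB.instance Definition _ (A : pointedType) :=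
  isPointed.Build (full_shift A) (fun=> point).

Definition borel_full_shift (A : pointedType) :=
  g_sigma_algebraType [set U : set (full_shift A) | open U].

Section Subshift.
Variable A : pointedType.
Implicit Types (x : full_shift A) (X B : set (full_shift A)) (w : seq A).

Definition left_shift x : full_shift A := fun i : int => x (i + 1).

(* The r-th power of the shift, for r in Z; see shiftz_nat and shiftzK. *)
Definition shiftz (r : int) x : full_shift A := fun i : int => x (i + r).

Lemma shiftz_nat (n : nat) x : shiftz n%:Z x = iter n left_shift x.
Proof.
elim: n => [|n IHn] /=; first by apply/funext => i; rewrite /shiftz addr0.
by rewrite -IHn; apply/funext => i; rewrite /left_shift /shiftz intS addrA.
Qed.

Lemma shiftzK (r : int) : cancel (shiftz r) (shiftz (- r)).
Proof. by move=> x; apply/funext => i; rewrite /shiftz subrK. Qed.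

Definition subshift X : Prop := closed X /\ left_shift @` X = X.

Definition subword x (i : int) (n : nat) : seq A :=
  mkseq (fun k => x (i + k%:Z) : A) n.

Definition language_n X (n : nat) : set (seq A) :=
  [set w | exists x i, X x /\ subword x i n = w].

Definition language X : set (seq A) := \bigcup_n language_n X n.

Definition cylinder X w : set (full_shift A) :=
  [set x | X x /\ subword x 1 (size w) = w].

Definition shifted_cylinder X (r : int) w : set (full_shift A) :=
  shiftz r @^-1` cylinder X w.

Definition complete_trap X B : Prop :=
  [/\ measurable (B : set (borel_full_shift A)), B `<=` X &
      forall x, X x -> exists n : int, B (shiftz n x)].

End Subshift.

Section Measure.
Context (R : realType) (A : pointedType).
Variables (X : set (full_shift A)) (mu : probability (borel_full_shift A) R).

Local Open Scope ereal_scope.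

(* A Borel probability measure on X is encoded as a Borel probability measure
   on A^Z that gives X full mass. *)
Definition carried_by : Prop := mu X = 1.

Definition shift_invariant : Prop :=
  forall B : set (borel_full_shift A), measurable B ->
    mu (@left_shift A @^-1` B) = mu B.

Definition positive_on_cylinders : Prop :=
  forall w, language X w -> 0 < mu (cylinder X w).

Definition mixing : Prop :=
  forall w w', language X w -> language X w' ->
    mu (shifted_cylinder X n%:Z w `&` cylinder X w') @[n --> \oo]
      --> mu (cylinder X w) * mu (cylinder X w').

Definition non_atomic : Prop := forall x, X x -> mu [set x] = 0.

End Measure.

(* Main.v *)
Require Import Defs.
From HB Require Import structures.
From mathcomp Require Import all_boot all_order all_algebra.
From mathcomp Require Import finmap all_classical all_reals all_analysis.
From mathcomp Require Import zify.

Set Implicit Arguments.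
Unset Strict Implicit.
Unset Printing Implicit Defensive.

Import Order.TTheory GRing.Theory Num.Theory.

Local Open Scope classical_set_scope.
Local Open Scope ring_scope.

(* If [w] has measure < eps/2, then [w] together with the words of length n
   avoiding [w] form a complete trap: the first n letters of a point either
   contain [w] or are one of these words.  The set E_n of points whose first n
   letters avoid [w] has measure tending to 0: its intersection E is disjoint
   from every sigma^-k [w], so mu(E_n) >= mu(E) + mu(E_n /\ sigma^-k [w]), and
   letting k, then n, go to infinity, mixing gives
   mu(E) >= mu(E) + mu(E) mu([w]).  Finally, a visit to [v] may be recorded at
   any time, so the trap survives shifting its i-th cylinder by i N; by mixing,
   for N large all pairs of the shifted cylinders meet in positive measure. *)

(** * Words, powers of the shift, and measurability of cylinders *)

Section Words.
Context {A : pointedType}.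
Implicit Types (x : full_shift A) (X : set (full_shift A)) (w : seq A).

Lemma subword_cat x i m n :
  subword x i (m + n) = subword x i m ++ subword x (i + m%:Z) n.
Proof.
rewrite /subword /mkseq iotaD map_cat add0n; congr (_ ++ _).
rewrite -[in iota m n](addn0 m) iotaDl -map_comp.
by apply: eq_map => k /=; rewrite PoszD addrA.
Qed.

Lemma size_subword x i n : size (subword x i n) = n.
Proof. exact: size_mkseq. Qed.

Lemma subword_shiftz r x i n : subword (shiftz r x) i n = subword x (i + r) n.
Proof. by apply: eq_mkseq => k; rewrite /shiftz addrAC. Qed.

Lemma infix_subword x i n w :
  infix w (subword x i n) -> exists j : nat, subword x (i + j%:Z) (size w) = w.
Proof.
move=> /infixP[p [s e]]; exists (size p).
have := congr1 size e; rewrite size_subword !size_cat => en.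
move: e; rewrite en !subword_cat => /eqP.
rewrite eqseq_cat ?size_subword// => /andP[_].
by rewrite eqseq_cat ?size_subword// => /andP[/eqP].
Qed.

Lemma subword_infix x i (j : nat) w :
  subword x (i + j%:Z) (size w) = w -> infix w (subword x i (j + size w)).
Proof. by move=> e; rewrite subword_cat e; exact: suffix_infix. Qed.

Lemma finite_words n :
  finite_set [set: A] -> finite_set [set w : seq A | size w = n].
Proof.
move=> fA; elim: n => [|n IHn].
  apply: (@sub_finite_set _ _ [set [::]]); last exact: finite_set1.
  by move=> w /= /size0nil ->.
apply: (@sub_finite_set _ _
  ((fun p => p.1 :: p.2) @` ([set: A] `*` [set w | size w = n]))).
  by move=> [//|a w] /= [sw]; exists (a, w).
by apply: finite_image; exact: finite_setX.
Qed.

(** For one step, [X] is its own image under the shift, which is injective. Positive powers follow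
    by iteration, negative ones by [shiftzK]. *)
Lemma shiftz_subshift X r x : subshift X -> X (shiftz r x) <-> X x.
Proof.
move=> [_ XE].
have X1 y : X (left_shift y) <-> X y.
  split=> [|Xy]; rewrite -{1}XE; last by exists y.
  move=> [z Xz /(congr1 (@shiftz A (-1)))].
  by rewrite -!/(shiftz 1 _) !shiftzK => <-.
have Xn (n : nat) y : X (shiftz n%:Z y) <-> X y.
  by rewrite shiftz_nat; elim: n => [//|n IHn] /=; rewrite X1.
case: (intP r) => [|n|n]; [exact: (Xn 0%N)|exact: Xn|].
by rewrite -(Xn n.+1) -{1}[(n.+1 : int)]opprK shiftzK.
Qed.

Lemma shifted_cylinderE X r w : subshift X ->
  shifted_cylinder X r w = [set x | X x /\ subword x (1 + r) (size w) = w].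
Proof.
move=> sX; apply/seteqP; split=> x; rewrite /shifted_cylinder/= /cylinder/=;
by rewrite subword_shiftz shiftz_subshift.
Qed.

Lemma shifted_cylinder0 X w : shifted_cylinder X 0 w = cylinder X w.
Proof.
rewrite /shifted_cylinder (_ : shiftz 0 = id) ?preimage_id//.
by apply/funext => x; apply/funext => i; rewrite /shiftz addr0.
Qed.

Lemma left_shift_shifted_cylinder X r w :
  @left_shift A @^-1` shifted_cylinder X r w = shifted_cylinder X (r + 1) w.
Proof.
rewrite /shifted_cylinder -comp_preimage.
rewrite (_ : shiftz r \o _ = shiftz (r + 1))//.
by apply/funext => x; apply/funext => i; rewrite /= /shiftz /left_shift addrA.
Qed.

Lemma language_subword X x i n : X x -> language X (subword x i n).
Proof. by move=> Xx; exists n => //; exists x, i. Qed.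

Lemma open_coordinate (i : int) (a : A) :
  open ([set x | x i = a] : set (full_shift A)).
Proof.
pose p (x : full_shift A) : discrete_topology A := x i.
have pc : continuous p.
  exact: (@proj_continuous int (fun=> discrete_topology A)).
exact: (@open_comp (full_shift A) (discrete_topology A) p [set a]
  (fun x _ => pc x) (discrete_open _)).
Qed.

Lemma measurable_shifted_cylinder X r w : subshift X ->
  measurable (shifted_cylinder X r w : set (borel_full_shift A)).
Proof.
move=> sX.
have mopen (U : set (full_shift A)) :
    open U -> measurable (U : set (borel_full_shift A)).
  exact: (@sub_sigma_algebra _ setT [set V : set (full_shift A) | open V]).
have mX : measurable (X : set (borel_full_shift A)).
  rewrite -[X]setCK; apply: measurableC; apply: mopen.
  by apply: closed_openC; case: sX.
(* Membership in the closed set [X] is combined with finitely many open conditions on single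
   coordinates. *)
rewrite shifted_cylinderE// [X in measurable X](_ : _ = X `&`
  \bigcap_(k in [set k | (k < size w)%N])
    [set x | x (1 + r + k%:Z) = nth point w k]).
  apply: measurableI => //; apply: bigcap_measurableType => k _.
  apply: mopen.
  exact: open_coordinate.
apply/seteqP; split=> x /= [Xx].
  by move=> e; split => // k /= kw; rewrite -[in RHS]e nth_mkseq.
move=> e; split => //; apply: (@eq_from_nth _ point); rewrite size_subword//.
by move=> k kw; rewrite nth_mkseq//; exact: e.
Qed.

End Words.

(** * Invariance, mixing and the points that avoid a word *)

Section InvariantMeasure.
Context {R : realType} {A : pointedType} (X : set (full_shift A)).
Variable mu : probability (borel_full_shift A) R.
Hypothesis X_subshift : subshift X.
Hypothesis mu_inv : shift_invariant mu.
Implicit Types w v : seq A.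

Local Open Scope ereal_scope.

Let mSC := @measurable_shifted_cylinder A X.

Lemma measure_shifted_cylinderI (n : nat) r s w v :
  mu (shifted_cylinder X (r + n%:Z) w `&` shifted_cylinder X (s + n%:Z) v) =
  mu (shifted_cylinder X r w `&` shifted_cylinder X s v).
Proof.
elim: n r s => [|n IHn] r s; first by rewrite !addr0.
rewrite intS !addrA IHn -!left_shift_shifted_cylinder -preimage_setI.
by apply: mu_inv; apply: measurableI; exact: mSC.
Qed.

Lemma measure_shifted_cylinder r w :
  mu (shifted_cylinder X r w) = mu (cylinder X w).
Proof.
(* Writing each cylinder as its intersection with itself makes [measure_shifted_cylinderI] apply; a
   negative [r] is moved forward to 0. *)
rewrite -shifted_cylinder0 -[LHS](congr1 mu (setIid _)).
rewrite -[RHS](congr1 mu (setIid _)).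
case: (intP r) => [//|n|n].
  by rewrite -[(n.+1 : int)]add0r measure_shifted_cylinderI.
by rewrite -(measure_shifted_cylinderI n.+1) addNr.
Qed.

Definition avoiding_words w n : set (seq A) :=
  [set v | language_n X n v /\ ~~ infix w v].

Definition avoiding_points w n : set (full_shift A) :=
  [set x | X x /\ ~~ infix w (subword x 1 n)].

(** This decomposition, disjoint since all the words have length [n] and finite for a finite
    alphabet, gives measurability and lets mixing act term by term. *)
Lemma avoiding_pointsE w n :
  avoiding_points w n = \bigcup_(v in avoiding_words w n) cylinder X v.
Proof.
apply/seteqP; split => x.
  move=> [Xx wx]; exists (subword x 1 n); last by split; rewrite ?size_subword.
  by split=> //; exists x, 1%R.
move=> [v [[y [i [Xy yv]]] wv] [Xx xv]]; split => //.
by move: xv; rewrite -{1}yv size_subword => ->.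
Qed.

Hypothesis A_finite : finite_set [set: A].

Lemma finite_avoiding_words w n : finite_set (avoiding_words w n).
Proof.
apply: (sub_finite_set _ (finite_words n A_finite)) => v [[x [i [_ <-]]] _] /=.
exact: size_subword.
Qed.

Lemma measurable_cylinder w :
  measurable (cylinder X w : set (borel_full_shift A)).
Proof. by rewrite -shifted_cylinder0; exact: mSC. Qed.

Lemma measurable_avoiding_points w n :
  measurable (avoiding_points w n : set (borel_full_shift A)).
Proof.
rewrite avoiding_pointsE; apply: fin_bigcup_measurable.
  exact: finite_avoiding_words.
by move=> v _; exact: measurable_cylinder.
Qed.

Lemma measure_avoiding_pointsI w n (B : set (borel_full_shift A)) :
  measurable B ->
  mu (B `&` avoiding_points w n) =
  \sum_(v <- fset_set (avoiding_words w n)) mu (B `&` cylinder X v).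
Proof.
move=> mB; have fW := finite_avoiding_words w n.
rewrite avoiding_pointsE setI_bigcupr measure_fin_bigcup ?fsbig_finite//.
(* Disjointness: two words of length [n] read at coordinate 1 of the same point agree. *)
- move=> u v [[y [i [_ yu]]] _] [[z [j [_ zv]]] _] [x [[_ [_ xu]] [_ [_ xv]]]].
  by rewrite -xu -xv -yu -zv !size_subword.
- by move=> v _; apply: measurableI => //; exact: measurable_cylinder.
Qed.

Hypothesis mu_mix : mixing X mu.

(** Mixing speaks of pairs of cylinders; finite additivity over the cylinders that make up
    [avoiding_points w n] extends it to that set. *)
Lemma mixing_avoiding_points w u n : language X u ->
  mu (shifted_cylinder X k%:Z u `&` avoiding_points w n) @[k --> \oo] -->
  mu (cylinder X u) * mu (avoiding_points w n).
Proof.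
move=> Lu.
have fW := finite_avoiding_words w n.
pose s : seq (seq A) := fset_set (avoiding_words w n).
(* Restricting the sum to [v \in s] keeps the membership that puts each [v] in the language, as
   [mu_mix] requires. *)
rewrite (_ : (fun k : nat => _) = fun k : nat =>
    \sum_(v <- s | v \in s) mu (shifted_cylinder X k%:Z u `&` cylinder X v)).
  2: apply/funext => k; rewrite -big_seq measure_avoiding_pointsI//.
  2: exact: mSC.
rewrite -[avoiding_points w n]setTI measure_avoiding_pointsI//.
rewrite ge0_sume_distrr// big_seq.
apply: cvg_nnesum => [v _|v]; first by apply: nearW => k; exact: measure_ge0.
rewrite in_fset_set// inE => -[[x [i [Xx <-]]] _].
rewrite setTI; apply: mu_mix => //; exact: language_subword.
Qed.

Lemma nonincreasing_avoiding_points w : nonincreasing_seq (avoiding_points w).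
Proof.
move=> m n mn; apply/subsetPset => x [Xx wx]; split => //.
by apply: contra wx => /infix_catr; rewrite -(subnKC mn) subword_cat; apply.
Qed.

Lemma cvg_measure_avoiding_points w :
  mu (avoiding_points w n) @[n --> \oo] --> mu (\bigcap_n avoiding_points w n).
Proof.
have mW n := measurable_avoiding_points w n.
apply: nonincreasing_cvg_mu => //.
- by rewrite -ge0_fin_numE// fin_num_measure.
- exact: bigcapT_measurable.
- exact: nonincreasing_avoiding_points.
Qed.

Lemma measure_never_visiting w : language X w -> 0 < mu (cylinder X w) ->
  mu (\bigcap_n avoiding_points w n) = 0.
Proof.
move=> Lw w0; set E := \bigcap_n _.
have mE : measurable (E : set (borel_full_shift A)).
  by apply: bigcapT_measurable => n; exact: measurable_avoiding_points.
have EW n : mu (cylinder X w) * mu (avoiding_points w n) + mu E <=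
    mu (avoiding_points w n).
  have cvgD : mu (shifted_cylinder X k%:Z w `&` avoiding_points w n) + mu E
      @[k --> \oo] -->
      mu (cylinder X w) * mu (avoiding_points w n) + mu E.
    apply: cvgeD; last exact: cvg_cst.
      by rewrite fin_num_adde_defl// fin_num_measure.
    exact: mixing_avoiding_points.
  apply: (cvge_le _ cvgD); apply: nearW => k.
  have mS : measurable (shifted_cylinder X k%:Z w `&` avoiding_points w n
      : set (borel_full_shift A)).
    by apply: measurableI; [exact: mSC|exact: measurable_avoiding_points].
  rewrite -measureU//.
    apply: le_measure; rewrite ?inE//; first exact: measurableU.
      exact: measurable_avoiding_points.
    by move=> x [[]//|]; apply.
  (* A point of sigma^-k [w] shows [w] within its first [k + size w] letters, so it already fails
     the condition of [E] at that index. *)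
  apply/seteqP; split => // x [[]].
  rewrite shifted_cylinderE// => -[Xx xw] _ /(_ (k + size w)%N I)[_].
  by rewrite subword_infix.
have Ecvg := @cvg_measure_avoiding_points w.
have : mu (cylinder X w) * mu E + mu E <= mu E.
  apply: (cvge_ge _ Ecvg); apply: nearW => n; apply: le_trans (EW n).
  apply: leeD => //; apply: lee_wpmul2l => //.
  apply: le_measure; rewrite ?inE//; first exact: measurable_avoiding_points.
  by move=> x; apply.
(* Finiteness of [mu E] lets it cancel, leaving mu([w]) mu(E) <= 0 with a positive first factor. *)
rewrite -leeBrDr ?subee ?fin_num_measure// => wE0.
apply/eqP; rewrite eq_le measure_ge0 andbT leNgt; apply/negP => E0.
by move: wE0; rewrite leNgt mule_gt0.
Qed.

Lemma avoiding_points_lt w (e : \bar R) :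
  language X w -> 0 < mu (cylinder X w) -> 0 < e ->
  exists n, mu (avoiding_points w n) < e.
Proof.
move=> Lw w0 e0; have Ecvg := @cvg_measure_avoiding_points w.
rewrite measure_never_visiting// in Ecvg.
have /Ecvg[n _ /(_ n (leqnn n)) We] : nbhs 0 [set y | y < e].
  by apply: open_nbhs_nbhs; split => //; exact: open_ereal_lt_ereal.
by exists n.
Qed.

(** Each limit mu([u]) mu([v]) is positive, and finitely many pairs share one threshold. This tells
    how far apart the cylinders of the trap are to be placed. *)
Lemma mixing_seq_gt0 (s : seq (seq A)) : positive_on_cylinders X mu ->
  {in s, forall v, language X v} ->
  \forall n \near \oo, {in s &, forall u v,
    0 < mu (shifted_cylinder X n%:Z u `&` cylinder X v)}.
Proof.
move=> mu_pos Ls.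
have near_all (P : seq A -> nat -> Prop) :
    {in s, forall v, \forall n \near \oo, P v n} ->
    \forall n \near \oo, {in s, forall v, P v n}.
  elim: (s) => [_|a t IHt Pt]; first by apply: nearW => n v; rewrite in_nil.
  apply: filterS2 (Pt a (mem_head _ _)) (IHt _) => [n Pa Pn v|v vt].
    by rewrite inE => /predU1P[->|/Pn].
  by apply: Pt; rewrite inE vt orbT.
suff H : {in s, forall u, \forall n \near \oo, {in s, forall v,
    0 < mu (shifted_cylinder X n%:Z u `&` cylinder X v)}}.
  by apply: filterS (near_all _ H) => n Pn u v us vs; exact: Pn.
move=> u us; apply: near_all => v vs.
have /(mu_mix (Ls _ us) (Ls _ vs)) :
    nbhs (mu (cylinder X u) * mu (cylinder X v)) [set y | 0 < y].
  apply: open_nbhs_nbhs; split; first exact: open_ereal_gt_ereal.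
  by rewrite /= mule_gt0// mu_pos//; exact: Ls.
exact.
Qed.

End InvariantMeasure.

(** Windows of [x] around the origin shrink to the null set {x}, so their measures tend to 0 by
    continuity from above; invariance then moves a window to coordinate 1. *)
Lemma cylinder_lt (R : realType) (A : pointedType) (X : set (full_shift A))
    (mu : probability (borel_full_shift A) R) (x : full_shift A) (e : \bar R) :
  subshift X -> shift_invariant mu -> X x -> mu [set x] = 0 -> (0 < e)%E ->
  exists2 w, language X w & (mu (cylinder X w) < e)%E.
Proof.
move=> sX mu_inv Xx x0 e0.
(* [w k] is [x] on the coordinates from -k to k - 1. Cylinders read from coordinate 1, hence the
   shift by -k - 1 in [N]. *)
pose w k := subword x (- k%:Z) k.*2.
pose N k := shifted_cylinder X (- k%:Z - 1) (w k).
have NE k : N k = [set y | X y /\ subword y (- k%:Z) k.*2 = w k].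
  by rewrite /N shifted_cylinderE// size_subword addrC subrK.
have mN k : measurable (N k : set (borel_full_shift A)).
  exact: measurable_shifted_cylinder.
have Nx : \bigcap_k N k = [set x].
  apply/seteqP; split=> [y Ny|_ -> k _]; last by rewrite NE.
  apply/funext => i.
  (* Radius |i| + 1 is large enough although the right end of the window is excluded. *)
  have := Ny (absz i).+1 I; rewrite NE => -[_].
  move=> /(congr1 (fun v => nth point v (absz (i + (absz i).+1)))).
  rewrite !nth_mkseq; try lia.
  by rewrite (_ : - _ + _ = i); [|lia].
have Ncvg : mu (N k) @[k --> \oo] --> 0%E.
  rewrite -[X in _ --> X]x0 -Nx; apply: nonincreasing_cvg_mu => //.
  - by rewrite -ge0_fin_numE// fin_num_measure.
  - exact: bigcapT_measurable.
  - apply/nonincreasing_seqP => k; apply/subsetPset => y; rewrite !NE.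
    (* The window for k + 1 is the one for k with one letter added at each end. *)
    move=> [Xy]; rewrite /w (_ : k.+1.*2 = 1 + (k.*2 + 1))%N; last by lia.
    rewrite !subword_cat (_ : - k.+1%:Z + 1 = - k%:Z); last by lia.
    by move=> /eqP; rewrite !eqseq_cat ?size_subword// => /and3P[_ /eqP].
have /Ncvg[k _ /(_ k (leqnn k)) Nk] : nbhs 0%E [set y | (y < e)%E].
  by apply: open_nbhs_nbhs; split => //; exact: open_ereal_lt_ereal.
exists (w k); first exact: language_subword.
by rewrite -(measure_shifted_cylinder sX mu_inv (- k%:Z - 1)).
Qed.


(** * Spacing the cylinders and checking the three properties of the trap *)

Theorem theorem2p4 (R : realType) (A : pointedType)
    (A_finite : finite_set [set: A])
    (X : set (full_shift A)) (X_subshift : subshift X)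
    (mu : probability (borel_full_shift A) R)
    (mu_X : carried_by X mu)
    (mu_inv : shift_invariant mu)
    (mu_pos : positive_on_cylinders X mu)
    (mu_mix : mixing X mu)
    (mu_nonatomic : non_atomic X mu)
    (eps : R) (eps_gt0 : 0 < eps) :
  exists (n : nat) (w : 'I_n -> seq A) (r : 'I_n -> int),
    (forall i, language X (w i)) /\
    let C := \bigcup_(i in [set: 'I_n]) shifted_cylinder X (r i) (w i) in
    [/\ (mu C < eps%:E)%E,
        complete_trap X C &
        forall i j : 'I_n,
          (0 < mu (shifted_cylinder X (r i) (w i) `&`
                   shifted_cylinder X (r j) (w j)))%E].
Proof.

have [x Xx] : X !=set0.
  apply/set0P/eqP => X0; move: mu_X; rewrite /carried_by X0 measure0 => /eqP.
  by rewrite eq_sym onee_eq0.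
have e0 : (0 < (eps / 2)%:E)%E by rewrite lte_fin divr_gt0.
have [w Lw we] := cylinder_lt X_subshift mu_inv Xx (mu_nonatomic x Xx) e0.
have [M We] := avoiding_points_lt X_subshift A_finite mu_mix Lw
  (mu_pos w Lw) e0.
pose W : seq (seq A) := fset_set (avoiding_words X w M).
have fW : finite_set (avoiding_words X w M) by exact: finite_avoiding_words.
pose s := w :: W.
have Ls : {in s, forall v, language X v}.
  move=> v; rewrite inE => /predU1P[->//|].
  by rewrite in_fset_set// inE => -[[y [i [Xy <-]]] _]; exact: language_subword.
(* Asking for all [n >= N] covers every positive multiple of the spacing at once; the threshold is
   taken at [N.+1], the spacing used in [r]. *)
have [N _ /(_ _ (leqnSn N))/= mixN] :
    \forall N \near \oo, forall n, (N <= n)%N -> {in s &, forall u v,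
      (0 < mu (shifted_cylinder X n%:Z u `&` cylinder X v))%E}.
  have [N _ HN] := mixing_seq_gt0 mu_mix mu_pos Ls.
  by exists N => // m /= Nm n mn; apply: HN; exact: leq_trans mn.
pose r (k : nat) : int := (k * N.+1)%N.
pose C (k : nat) := shifted_cylinder X (r k) (nth [::] s k).
have mC k : measurable (C k : set (borel_full_shift A)).
  exact: measurable_shifted_cylinder.
have CI i j : (j < i)%N -> (i < size s)%N -> (0 < mu (C i `&` C j))%E.
  move=> ji ilt; have jlt := ltn_trans ji ilt.
  (* Invariance removes the common shift [r j]; what remains is a shift by a positive multiple of
     [N.+1] against an unshifted cylinder. *)
  have Ci : C i = shifted_cylinder X (((i - j) * N.+1)%N%:Z + r j) (nth [::] s i).
    by rewrite /C /r -PoszD -mulnDl subnK// ltnW.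
  have Cj : C j = shifted_cylinder X (0 + r j) (nth [::] s j) by rewrite add0r.
  rewrite Ci Cj measure_shifted_cylinderI//.
  rewrite shifted_cylinder0; apply: mixN; rewrite ?mem_nth//.
  by rewrite leq_pmull// subn_gt0.
exists (size s), (fun i => nth [::] s i), (fun i => r i).
split=> [i|]; first by apply: Ls; exact: mem_nth.
set U := \bigcup_(i in _) _.
have UE : U = \bigcup_(i in `I_(size s)) C i.
  apply/seteqP; split => y [i ilt Cy]; first by exists (val i) => /=.
  by exists (Ordinal ilt).
have mU : measurable (U : set (borel_full_shift A)).
  by rewrite UE; exact: bigcup_measurable.
split => //.
- apply: (@le_lt_trans _ _ (\sum_(k < size s) mu (C k))%E).
    by apply: content_subadditive => //; rewrite UE bigcup_mkord.
  (* By invariance the shifts do not affect the bound: the head of [s] contributes mu([w]) and its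
     tail exactly mu(E_M), each below eps / 2. *)
  under eq_bigr do rewrite measure_shifted_cylinder//.
  rewrite -(big_mkord xpredT (fun k => mu (cylinder X (nth [::] s k)))).
  rewrite -(big_nth [::] xpredT (fun v => mu (cylinder X v))) big_cons.
  rewrite [eps]splitr EFinD; apply: lteD => //.
  apply: le_lt_trans We; rewrite -[avoiding_points X w M]setTI.
  rewrite measure_avoiding_pointsI// le_eqVlt; apply/orP; left; apply/eqP.
  by apply: eq_bigr => v _; rewrite setTI.
- split => // [|y Xy].
    rewrite UE => y [i _].
    by rewrite /C shifted_cylinderE// => -[].
  have [v vs [j yv]] : exists2 v, v \in s &
      exists j : nat, subword y (1 + j%:Z) (size v) = v.
    have [/infix_subword yw|wy] := boolP (infix w (subword y 1 M)).
      by exists w => //; exact: mem_head.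
    exists (subword y 1 M); last by exists 0%N; rewrite addr0 size_subword.
    rewrite inE in_fset_set//; apply/orP; right; rewrite inE; split => //.
    by exists y, 1.
  (* [v] occurs in [y] at 1 + j, while its shifted cylinder reads at 1 + [r (index v s)]; the
     difference, possibly negative, aligns the two. *)
  exists (j%:Z - r (index v s)); rewrite UE; exists (index v s).
    by rewrite -index_mem in vs.
  rewrite /C nth_index// shifted_cylinderE//; split.
    exact/shiftz_subshift.
  by rewrite subword_shiftz addrAC -addrA subrK.
- move=> i j; have [ij|ji|/val_inj ->] := ltngtP i j.
  + by rewrite setIC; exact: CI.
  + exact: CI.
  + rewrite setIid measure_shifted_cylinder//; apply: mu_pos; apply: Ls.
    exact: mem_nth.
Qed.
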